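(* There is an absolute constant $C>0$ such that the following holds. Let $m\geq 3$, $n\geq 1$, $\epsilon\geq 0$, and let $f:S_m^n\to S_m$ be $\epsilon$-IR, i.e. $$\sum_{i\in[n],\,j\in[m]}\Pr_{x^{-i}\in S_m^{n-1},\,x_i,y_i\in S_m}\Big[\big(x_i^{-1}(j)=y_i^{-1}(j)\big)\wedge\big(f(x^{-i},x_i)^{-1}(j)\neq f(x^{-i},y_i)^{-1}(j)\big)\Big]\leq\epsilon,$$ where $x^{-i},x_i,y_i$ are independent and uniform. Then there is a function $h:S_m^n\to S_m$ which is either constant or of the form $h(x)=x_i\circ y$ (i.e. $h(x)(r)=x_i(y(r))$) for some voter $i\in[n]$ and some $y\in S_m$, such that $$\mathbb{E}_{x\in S_m^n}\big\|P(f(x))-P(h(x))\big\|_F^2\leq C\,m^8\,\epsilon,$$ with $x$ uniform on $S_m^n$.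
   Context: $S_m$ is the symmetric group on $[m]$; a ranking $x\in S_m$ uses the convention $x(\text{rank})=\text{name}$, so $x^{-1}(j)$ is the rank of alternative $j$. A profile is $x=(x_1,\dots,x_n)\in S_m^n$, and $(x^{-i},y_i)$ is the profile with $x_i$ replaced by $y_i$. $\circ$ is ordinary composition. For $z\in S_m$, $P(z)$ is the $m\times m$ permutation matrix $P(z)_{ab}=\mathbf 1_{z(a)=b}$, and $\|\cdot\|_F$ is the Frobenius norm. (The quantity $\|P(a)-P(b)\|_F^2$ equals $\|\rho^1(a)-\rho^1(b)\|_F^2$, where $\rho^1$ is the standard $(m-1)$-dimensional orthogonal representation of $S_m$, which is the encoding the paper uses.) *)

(* Defs.v *)
From mathcomp Require Import all_boot all_order all_algebra all_fingroup.
From mathcomp Require Import reals.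

Set Implicit Arguments.
Unset Strict Implicit.
Unset Printing Implicit Defensive.

Import Order.TTheory GRing.Theory Num.Theory.
Local Open Scope ring_scope.

Definition expectation_unif (R : realType) (T : finType) (g : T -> R) : R :=
  (\sum_(t : T) g t) / #|T|%:R.

Definition prob_unif (R : realType) (T : finType) (A : pred T) : R :=
  #|A|%:R / #|T|%:R.

Definition frobenius_norm (R : realType) (m n : nat) (A : 'M[R]_(m, n)) : R :=
  Num.sqrt (\sum_(a < m) \sum_(b < n) `|A a b| ^+ 2).

(* A ranking x : 'S_m maps ranks to names, so (x^-1)%g j is the rank of j. *)
Definition profile (m n : nat) : finType := {ffun 'I_n -> 'S_m}.

Definition replace_vote (m n : nat) (x : profile m n) (i : 'I_n) (y : 'S_m) :
    profile m n :=
  [ffun k => if k == i then y else x k].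

(* Independent uniform x^{-i}, x_i, y_i are encoded by a uniform pair
   (x, y) : profile m n * 'S_m. *)
Definition IR_defect (R : realType) (m n : nat) (f : profile m n -> 'S_m)
    (i : 'I_n) (j : 'I_m) : R :=
  prob_unif R (fun w : profile m n * 'S_m =>
    let: (x, y) := w in
    (((x i)^-1)%g j == (y^-1)%g j)
    && (((f x)^-1)%g j != ((f (replace_vote x i y))^-1)%g j)).

Definition is_IR (R : realType) (m n : nat) (eps : R)
    (f : profile m n -> 'S_m) : Prop :=
  \sum_(i < n) \sum_(j < m) IR_defect R f i j <= eps.

Definition is_constant (m n : nat) (h : profile m n -> 'S_m) : Prop :=
  exists z : 'S_m, forall x, h x = z.

(* Stated pointwise because ( * )%g on 'S_m composes left to right. *)
Definition is_dictatorial (m n : nat) (h : profile m n -> 'S_m) : Prop :=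
  exists (i : 'I_n) (y : 'S_m), forall x (r : 'I_m), h x r = x i (y r).

(* Main.v *)
(* Write X^j for the vector of ranks that the voters give to alternative j.
   Re-randomizing the ballots one voter at a time while keeping X^j shows that the
   rank of j in f(x) is, up to probability O(m eps), a function F_j(X^j).  Fix a
   rank r and put A_j = 1[F_j = r], so that sum_j A_j(X^j) is nearly 1.  For j <> k
   the correlation between X^j and X^k multiplies the degree-s part of a function
   by (-1/(m-1))^s; for m >= 3 this makes the quadratic form E(sum_j A_j(X^j) - 1)^2
   control the parts of degree >= 2 of all the A_j as well as the differences of
   their degree-1 parts.  Hence A_j is close to c_j + sum_i phi_i with phi
   independent of j, and a Boolean function close to a sum of functions of
   independent coordinates depends essentially on one of them.  So f(x)(r) is
   either nearly constant or nearly x_i(a), and since f(x) is a permutation the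
   choices made at the different ranks must be compatible. *)
Require Import Defs.
From HB Require Import structures.
From mathcomp Require Import all_boot all_order all_algebra all_fingroup.
From mathcomp Require Import reals ring lra zify.

Set Implicit Arguments.
Unset Strict Implicit.
Unset Printing Implicit Defensive.

Import Order.TTheory GRing.Theory Num.Theory.
Local Open Scope ring_scope.

(** * Boolean functions close to additive ones *)

Definition upd {I T : finType} (x : {ffun I -> T}) (i : I) (a : T) :
    {ffun I -> T} :=
  [ffun k => if k == i then a else x k].

(** * Double counting by resampling one coordinate of a product space *)

Section Counting.
Local Open Scope nat_scope.

Lemma ex_good {T : finType} (P : pred T) :
  \sum_t P t < #|T| -> exists t, ~~ P t.
Proof.
move=> lt; apply/existsP; rewrite -negb_forall; apply: contraL lt => /forallP allP.
by rewrite -leqNgt -sum1_card leq_sum // => t _; rewrite allP.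
Qed.

Lemma ex_le_average {T : finType} (F : T -> nat) K :
  0 < #|T| -> \sum_t F t <= #|T| * K -> exists t, F t <= K.
Proof.
move=> T0 le; apply/existsP; apply: contraTT le; rewrite negb_exists => /forallP h.
rewrite -ltnNge -sum_nat_const; case/card_gt0P: T0 => t0 _.
rewrite (bigD1 t0) //= [X in _ < X](bigD1 t0) //= -addSn leq_add //.
  by rewrite ltnNge h.
by apply: leq_sum => t _; rewrite ltnW // ltnNge h.
Qed.

Context {I T : finType}.
Implicit Types (x u : {ffun I -> T}).

Lemma upd_eq x i a : upd x i a i = a. Proof. by rewrite ffunE eqxx. Qed.

Lemma upd_neq x i k a : k != i -> upd x i a k = x k.
Proof. by rewrite ffunE => /negbTE ->. Qed.

Lemma upd_id x i : upd x i (x i) = x.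
Proof. by apply/ffunP => k; rewrite ffunE; case: eqP => // ->. Qed.

Lemma upd_upd x i a b : upd (upd x i a) i b = upd x i b.
Proof. by apply/ffunP => k; rewrite !ffunE; case: eqP. Qed.

Lemma updC x i k a b : i != k -> upd (upd x i a) k b = upd (upd x k b) i a.
Proof.
by move=> ik; apply/ffunP => l; rewrite !ffunE; case: eqP => [->|//]; rewrite eq_sym (negbTE ik).
Qed.

(** Exchanging coordinate [i] with an independent sample is an involution on pairs. *)
Lemma sum_upd_swap (V : nmodType) i (F : {ffun I -> T} -> T -> V) :
  (\sum_(x : {ffun I -> T}) \sum_y F x y = \sum_(x : {ffun I -> T}) \sum_y F (upd x i y) (x i))%R.
Proof.
rewrite !pair_big /=.
rewrite (reindex_inj (h := fun p => (upd p.1 i p.2, p.1 i))) //=.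
apply: (@can_inj _ _ _ (fun p => (upd p.1 i p.2, p.1 i))) => -[x y] /=.
by rewrite upd_upd upd_id upd_eq.
Qed.

Lemma sum_coord (i : I) (F : T -> nat) :
  #|T| * \sum_(x : {ffun I -> T}) F (x i) = #|{ffun I -> T}| * \sum_a F a.
Proof.
have := sum_upd_swap i (fun x _ => F (x i)).
rewrite exchange_big /= sum_nat_const => ->.
by rewrite -sum_nat_const; apply: eq_bigr => x _; apply: eq_bigr => y _; rewrite upd_eq.
Qed.

Lemma sum_upd_le (i : I) a (F : {ffun I -> T} -> nat) :
  \sum_(x : {ffun I -> T}) F (upd x i a) <= #|T| * \sum_x F x.
Proof.
have := sum_upd_swap i (fun x _ => F x).
rewrite exchange_big /= sum_nat_const => ->.
by apply: leq_sum => x _; rewrite (bigD1 a) //= leq_addr.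
Qed.

(** The points with [x i = a] form a fraction [1 / #|T|] of the space, so a rarer event cannot cover
    them. *)
Lemma coord_attained (i : I) (a : T) (P : pred {ffun I -> T}) :
  #|T| * \sum_x P x < #|{ffun I -> T}| ->
  exists2 x : {ffun I -> T}, x i = a & ~~ P x.
Proof.
move=> lt.
have [x nP] : exists x, ~~ P (upd x i a).
  by apply: ex_good; apply: leq_ltn_trans lt; exact: sum_upd_le i a (fun x => P x).
by exists (upd x i a); rewrite ?upd_eq.
Qed.

End Counting.

Section AdditiveBoolean.
Context {R : realFieldType} {n : nat} {T : finType}.
Variables (A : {ffun 'I_n -> T} -> bool) (c : R) (phi : 'I_n -> T -> R).
Local Notation Om := {ffun 'I_n -> T}.

Definition additive_fun (u : Om) : R := c + \sum_i phi i (u i).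
Local Notation L := additive_fun.

(** Between two points that are not far, [L] changes by an integer up to an error below 1/8. *)
Definition far (u : Om) : bool := 16^-1 <= `|(A u)%:R - L u|.

Lemma additive_upd u i a b :
  L (upd u i a) - L (upd u i b) = phi i a - phi i b.
Proof.
rewrite /L (bigD1 i) //= [X in _ - (_ + X)](bigD1 i) //= !upd_eq.
rewrite (eq_bigr (fun k => phi k (upd u i b k))); last first.
  by move=> k ki; rewrite !upd_neq.
by ring.
Qed.

(** An increment of [L] between points that are not far is near -1, 0 or 1, so one of at least 1/8
    is near 1. Then [A] jumps along coordinate [i], which pins the level of [L] and leaves [u i] as
    the only variable. *)
Lemma additive_influential i a b :
  8^-1 <= phi i a - phi i b ->
  (2 * #|T| * \sum_u far u < #|{ffun 'I_n -> T}|)%N ->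
  exists g : T -> bool,
    (\sum_u (A u != g (u i)) <= (1 + 2 * #|T|) * \sum_u far u)%N.
Proof.
move=> D8 lt.
have fl u : far u = false -> `|(A u)%:R - L u| < 16^-1.
  by rewrite /far => /negbT; rewrite -ltNge.
have D78 : 7 / 8 < phi i a - phi i b.
  have [u] : exists u, ~~ (far (upd u i a) || far (upd u i b)).
    apply: ex_good; apply: leq_ltn_trans lt.
    apply: (@leq_trans (\sum_u (far (upd u i a) + far (upd u i b)))%N).
      by apply: leq_sum => u _; case: far; case: far.
    rewrite big_split /= -mulnA mul2n -addnn leq_add //.
      exact: (sum_upd_le i a (fun u => far u)).
    exact: (sum_upd_le i b (fun u => far u)).
  rewrite negb_or => /andP[/negbTE /fl ha /negbTE /fl hb].
  move: ha hb (additive_upd u i a b); rewrite !ltr_norml.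
  by case: (A (upd u i a)); case: (A (upd u i b)) => /=; lra.
(* At [upd u i a] the function [L] is near 1; [g] rounds the value that this predicts for [L u]. *)
exists (fun t => 2^-1 < 1 + phi i t - phi i a).
apply: (@leq_trans (\sum_u (far u + (far (upd u i a) + far (upd u i b))))%N); last first.
  rewrite big_split mulnDl mul1n leq_add2l big_split /= -mulnA mul2n -addnn leq_add //.
    exact: (sum_upd_le i a (fun u => far u)).
  exact: (sum_upd_le i b (fun u => far u)).
apply: leq_sum => u _.
case E0: (far u); first by case: eqP.
case Ea: (far (upd u i a)); first by case: eqP.
case Eb: (far (upd u i b)); first by case: eqP.
move: (fl _ E0) (fl _ Ea) (fl _ Eb) (additive_upd u i a b) (additive_upd u i (u i) a).
rewrite upd_id !ltr_norml.
case: (A (upd u i a)); case: (A (upd u i b)); case: (A u) => /=;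
  case: (ltP 2^-1 (1 + phi i (u i) - phi i a)) => //=; lra.
Qed.

Let psum (p : Om * Om) (k : nat) : R :=
  \sum_(i < n | (i < k)%N) (phi i (p.1 i) - phi i (p.2 i)).
(** The sum [psum p i] omits coordinate [i], so the coordinate that first carries the sum out of the
    interval is still exchanged. *)
Let run (p : Om * Om) (i : 'I_n) : bool :=
  [forall k : 'I_n, (k <= i)%N ==> (`|psum p k| < 4^-1)].
Let swap (p : Om * Om) : Om * Om :=
  ([ffun i => if run p i then p.2 i else p.1 i],
   [ffun i => if run p i then p.1 i else p.2 i]).

Let psum_swap p k : (forall i : 'I_n, (i < k)%N -> run p i) -> psum (swap p) k = - psum p k.
Proof.
move=> h; rewrite /psum -sumrN; apply: eq_bigr => i ik.
by rewrite !ffunE h // opprB.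
Qed.

(** The exchange only negates the partial sums up to the stop, so both pairs stop at the same time;
    hence [swap] is an involution. *)
Let run_swap p i : run (swap p) i = run p i.
Proof.
apply/idP/idP => /forallP h; apply/forallP => k; apply/implyP => ki.
  elim/ltn_ind: {k}(nat_of_ord k) {-2}k (erefl (nat_of_ord k)) ki => k0 IH k Ek ki.
  rewrite -[psum p k]opprK normrN -psum_swap; first by have := h k; rewrite ki.
  move=> l lk; apply/forallP => q; apply/implyP => ql.
  by rewrite (IH q) //; [rewrite -Ek (leq_ltn_trans ql) | lia].
rewrite psum_swap ?normrN; first by have := h k; rewrite ki.
move=> l lk; apply/forallP => q; apply/implyP => ql.
by have := h q; rewrite (leq_trans ql) // (leq_trans (ltnW lk)).
Qed.

Let swapK : involutive swap.
Proof.
move=> p; have := run_swap p; case: p => u v r; rewrite {1}/swap.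
by congr (_, _); apply/ffunP => i; rewrite ffunE r !ffunE /=; case: run.
Qed.

(* The exchange of the two points stops at the first time their partial
   difference leaves (-1/4, 1/4); it preserves the uniform measure on pairs, and
   at a stop the increment of [L] is too far from an integer. *)
Lemma additive_uninfluential :
  (forall i a b, phi i a - phi i b < 8^-1) -> (0 < #|{ffun 'I_n -> T}|)%N ->
  exists v, (\sum_u (A u != A v) <= 3 * \sum_u far u)%N.
Proof.
move=> D8 N0.
have fl u : far u = false -> `|(A u)%:R - L u| < 16^-1.
  by rewrite /far => /negbT; rewrite -ltNge.
apply: ex_le_average => //.
rewrite exchange_big pair_big /=.
(* Three events, each with the density of [far] because [swap] preserves the uniform measure: this
   is the constant 3. *)
apply: (@leq_trans (\sum_p (far p.1 + (far p.2 + far (swap p).1)))%N); last first.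
  have S1 : (\sum_(p : Om * Om) far p.1 = #|{ffun 'I_n -> T}| * \sum_u far u)%N.
    rewrite -(pair_big predT predT (fun u _ => far u : nat)) exchange_big /=.
    by rewrite sum_nat_const.
  have S2 : (\sum_(p : Om * Om) far p.2 = #|{ffun 'I_n -> T}| * \sum_u far u)%N.
    by rewrite -(pair_big predT predT (fun _ u => far u : nat)) /= sum_nat_const.
  have S3 : (\sum_p far (swap p).1 = \sum_(p : Om * Om) far p.1)%N.
    by rewrite [RHS](reindex_inj (inv_inj swapK)).
  by rewrite !big_split /= S3 S1 S2 [leqRHS]mulnCA !mulSn mul0n addn0.
apply: leq_sum => p _.
case E1: (far p.1); first by case: eqP.
case E2: (far p.2); first by case: eqP.
case Ez: (far (swap p).1); first by case: eqP.
case: eqP => // /eqP nA; exfalso.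
have Ln : L p.1 - L p.2 = psum p n.
  rewrite /L /psum opprD addrACA subrr add0r -sumrB.
  by apply: eq_bigl => i; rewrite ltn_ord.
(* Different values of [A] force [L p.1 - L p.2] above 7/8 in absolute value, so the sum does leave
   the interval. *)
have exk : exists k, (k <= n)%N && (4^-1 <= `|psum p k|).
  exists n; rewrite leqnn -Ln /=.
  move: nA (fl _ E1) (fl _ E2); rewrite !ltr_norml ler_normr.
  by case: (A p.1); case: (A p.2) => //= _; lra.
case: (ex_minnP exk) => k /andP[kn bk] kmin.
have small q : (q < k)%N -> `|psum p q| < 4^-1.
  move=> qk; rewrite ltNge; apply/negP => bq.
  by have := kmin q; rewrite bq (ltnW (leq_trans qk kn)) => /(_ isT); lia.
have runE (i : 'I_n) : run p i = (i < k)%N.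
  apply/forallP/idP => [h|ik q].
    rewrite ltnNge; apply/negP => ki.
    have := h (Ordinal (leq_ltn_trans ki (ltn_ord i))).
    by rewrite /= ki /= ltNge bk.
  by apply/implyP => qi; apply: small; apply: leq_ltn_trans ik.
have Lz : L p.1 - L (swap p).1 = psum p k.
  rewrite /L /psum opprD addrACA subrr add0r -sumrB big_mkcond [RHS]big_mkcond /=.
  by apply: eq_bigr => i _; rewrite ffunE runE; case: ifP; rewrite ?subrr.
(* Before the exit the sum is below 1/4 and one step adds less than 1/8. The result in [1/4, 3/8) is
   not within 1/8 of an integer. *)
have bk' : `|psum p k| < 3 / 8.
  case: k => [|k] in kn bk kmin small runE Lz *.
    by rewrite /psum big_pred0 // normr0; lra.
  have : psum p k.+1 =
      psum p k + (phi (Ordinal kn) (p.1 (Ordinal kn)) -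
                  phi (Ordinal kn) (p.2 (Ordinal kn))).
    rewrite /psum (bigD1 (Ordinal kn)) //= addrC; congr (_ + _).
    apply: eq_bigl => i; rewrite ltnS -(inj_eq val_inj) /=; lia.
  have := small k (leqnn _).
  have := D8 (Ordinal kn) (p.1 (Ordinal kn)) (p.2 (Ordinal kn)).
  have := D8 (Ordinal kn) (p.2 (Ordinal kn)) (p.1 (Ordinal kn)).
  move=> ? ? + ->; rewrite !ltr_norml; lra.
move: bk bk' (fl _ E1) (fl _ Ez); rewrite -Lz !ltr_norml ler_normr.
by case: (A p.1); case: (A (swap p).1) => /=; lra.
Qed.

Lemma boolean_near_additive :
  (0 < n)%N -> (2 * #|T| * \sum_u far u < #|{ffun 'I_n -> T}|)%N ->
  exists (i : 'I_n) (g : T -> bool),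
    (\sum_u (A u != g (u i)) <= 4 * #|T| * \sum_u far u)%N.
Proof.
move=> n0 lt.
have N0 : (0 < #|{ffun 'I_n -> T}|)%N by lia.
have T0 : (0 < #|T|)%N.
  by rewrite card_ffun card_ord expn_gt0 in N0; lia.
have [/existsP[i /existsP[a /existsP[b D8]]]|] :=
  boolP [exists i, exists a, exists b, 8^-1 <= phi i a - phi i b].
  have [g hg] := additive_influential D8 lt; exists i, g.
  by apply: leq_trans hg _; rewrite leq_mul2r; apply/orP; right; lia.
rewrite negb_exists => /forallP h.
have [i a b|//|v hv] := additive_uninfluential.
  have := h i; rewrite negb_exists => /forallP /(_ a).
  by rewrite negb_exists => /forallP /(_ b); rewrite -ltNge.
(* With a constant [g] the coordinate is only a default. *)
exists (Ordinal n0), (fun=> A v); apply: leq_trans hv _.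
by rewrite leq_mul2r; apply/orP; right; lia.
Qed.

End AdditiveBoolean.

(** * Commuting self-adjoint projections *)

Section CommutingProjections.
Context {R : realFieldType} {V : lmodType R} {I : eqType}.
Variables (dot : V -> V -> R) (E : I -> {linear V -> V}) (t : R).
Hypothesis dotDl : forall u v w, dot (u + v) w = dot u w + dot v w.
Hypothesis dotZl : forall a u w, dot (a *: u) w = a * dot u w.
Hypothesis dotC : forall u v, dot u v = dot v u.
Hypothesis dot_ge0 : forall u, 0 <= dot u u.
Hypothesis E_sym : forall i u v, dot (E i u) v = dot u (E i v).
Hypothesis E_idem : forall i u, E i (E i u) = E i u.
Hypothesis E_comm : forall i k u, E i (E k u) = E k (E i u).

Definition res i (u : V) : V := u - E i u.
(** Eigenvalue 1 on the range of [E i] and [-t] on its kernel; thus [contrs] has eigenvalue [(-t)^s]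
    on the part of degree s. *)
Definition contr i (u : V) : V := E i u - t *: res i u.
Definition contrs (s : seq I) (u : V) : V := foldr contr u s.
Definition avgs (s : seq I) (u : V) : V := foldr (fun i => E i) u s.
(** The projection onto degree at most 1: at most one index of the list contributes its residual. *)
Fixpoint linear_part (s : seq I) (u : V) : V :=
  if s is i :: s' then linear_part s' (E i u) + avgs s' (res i u) else u.

Lemma dotDr u v w : dot u (v + w) = dot u v + dot u w.
Proof. by rewrite dotC dotDl !(dotC u). Qed.
Lemma dotZr a u w : dot u (a *: w) = a * dot u w.
Proof. by rewrite dotC dotZl dotC. Qed.
Lemma dotNr u w : dot u (- w) = - dot u w.
Proof. by rewrite -scaleN1r dotZr mulN1r. Qed.
Lemma dotNl u w : dot (- u) w = - dot u w.
Proof. by rewrite dotC dotNr dotC. Qed.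

Lemma E_res i u : E i (res i u) = 0.
Proof. by rewrite /res linearB E_idem subrr. Qed.
Lemma resK i u : E i u + res i u = u.
Proof. by rewrite /res addrC subrK. Qed.
Lemma res_E i k u : E i (res k u) = res k (E i u).
Proof. by rewrite /res linearB /= E_comm. Qed.
Lemma resD k u v : res k (u + v) = res k u + res k v.
Proof. by rewrite /res linearD opprD addrACA. Qed.
Lemma contr_E i k u : E i (contr k u) = contr k (E i u).
Proof. by rewrite /contr linearB linearZ /= E_comm res_E. Qed.
Lemma contrs_E s i u : E i (contrs s u) = contrs s (E i u).
Proof. by elim: s => //= k s <-; rewrite contr_E. Qed.
Lemma avgs_E s i u : E i (avgs s u) = avgs s (E i u).
Proof. by elim: s => //= k s <-; rewrite E_comm. Qed.
Lemma linear_part_E s i u : E i (linear_part s u) = linear_part s (E i u).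
Proof.
by elim: s u => //= k s IH u; rewrite linearD /= IH avgs_E E_comm res_E.
Qed.
Lemma contrD k u v : contr k (u + v) = contr k u + contr k v.
Proof. by rewrite /contr linearD resD scalerDr opprD addrACA. Qed.
Lemma contrZ k a u : contr k (a *: u) = a *: contr k u.
Proof.
by rewrite /contr /res linearZ /= -scalerBr !scalerA mulrC -scalerA -scalerBr.
Qed.
Lemma contrsD s u v : contrs s (u + v) = contrs s u + contrs s v.
Proof. by elim: s => //= k s ->; rewrite contrD. Qed.
Lemma contrsZ s a u : contrs s (a *: u) = a *: contrs s u.
Proof. by elim: s => //= k s ->; rewrite contrZ. Qed.
Lemma contrsN s u : contrs s (- u) = - contrs s u.
Proof. by rewrite -scaleN1r contrsZ scaleN1r. Qed.
Lemma avgsZ s a u : avgs s (a *: u) = a *: avgs s u.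
Proof. by elim: s => //= k s ->; rewrite linearZ. Qed.

Lemma dot_E_res i u v : E i u = u -> E i v = 0 -> dot u v = 0.
Proof. by move=> <- Ev; rewrite E_sym Ev -(scale0r 0) dotZr mul0r. Qed.

Lemma norm_split i u v : E i u = u -> E i v = 0 ->
  dot (u + v) (u + v) = dot u u + dot v v.
Proof.
by move=> Eu Ev; rewrite dotDl !dotDr (dotC v u) (dot_E_res Eu Ev) addr0 add0r.
Qed.

Lemma dot_resK i u : dot u u = dot (E i u) (E i u) + dot (res i u) (res i u).
Proof. by rewrite -{1 2}(resK i u) (@norm_split i) ?E_idem ?E_res. Qed.

Lemma dot_contrs_cons i s u :
  dot u (contrs (i :: s) u) =
  dot (E i u) (contrs s (E i u)) - t * dot (res i u) (contrs s (res i u)).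
Proof.
rewrite /= /contr {1}/res contrs_E.
have -> : contrs s u - contrs s (E i u) = contrs s (res i u).
  by rewrite -contrsN -contrsD.
rewrite -{1}(resK i u) dotDl !dotDr !dotNr !dotZr.
have c0 : contrs s 0 = 0 by rewrite -(scale0r 0) contrsZ !scale0r.
rewrite (@dot_E_res i (E i u) (contrs s (res i u))) ?E_idem ?contrs_E ?E_res //.
rewrite (dotC (res i u) (contrs s (E i u))) (@dot_E_res i _ (res i u)).
- by rewrite mulr0 oppr0 addr0 add0r.
- by rewrite contrs_E E_idem.
by rewrite E_res.
Qed.

Hypotheses (t0 : 0 < t) (t12 : t <= 2^-1).

Let tt : t * t <= 4^-1.
Proof. by have := ler_wpM2l (ltW t0) t12; move: t12; lra. Qed.

(** The eigenvalues [(-t)^s] lie between [-t] and 1. *)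
Lemma dot_contrs_bounds s u :
  - t * dot u u <= dot u (contrs s u) <= dot u u.
Proof.
elim: s u => [|i s IH] u; first rewrite /= lexx andbT mulNr.
  have := mulr_ge0 (ltW t0) (dot_ge0 u); have := dot_ge0 u; lra.
rewrite dot_contrs_cons (dot_resK i u).
move: (IH (E i u)) (IH (res i u)) (dot_ge0 (E i u)) (dot_ge0 (res i u)).
move: (dot (E i u) (contrs _ _)) (dot (res i u) (contrs _ _)) => a b.
move: (dot (E i u) _) (dot (res i u) _) => x y /andP[a1 a2] /andP[b1 b2] x0 y0.
have := ler_wpM2l (ltW t0) b1; have := ler_wpM2l (ltW t0) b2.
by have := ler_wpM2r y0 tt => *; apply/andP; split; lra.
Qed.

(** In degree s >= 1 the eigenvalue [(-t)^s] is at most [t^2 <= 1/4]. *)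
Lemma contrs_gap s u :
  3 / 4 * (dot u u - dot (avgs s u) (avgs s u)) <= dot u u - dot u (contrs s u).
Proof.
elim: s u => [|i s IH] u; first by rewrite /= !subrr mulr0.
have -> : avgs (i :: s) u = avgs s (E i u) by rewrite /= avgs_E.
rewrite dot_contrs_cons (dot_resK i u).
move: (IH (E i u)) (dot_contrs_bounds s (res i u)) (dot_ge0 (res i u)).
move: (dot (E i u) (contrs _ _)) (dot (res i u) (contrs _ _)) => a b.
move: (dot (avgs _ _) _) (dot (E i u) _) (dot (res i u) _) => z x y.
move=> a1 /andP[b1 _] y0; have := ler_wpM2l (ltW t0) b1.
by have := ler_wpM2r y0 tt; lra.
Qed.

Lemma dot_avgs s u : dot u (avgs s u) = dot (avgs s u) (avgs s u).
Proof.
elim: s u => //= i s IH u.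
by rewrite -{1}[E i _]E_idem -E_sym avgs_E IH.
Qed.

Lemma norm_sub_avgs s u :
  dot (u - avgs s u) (u - avgs s u) = dot u u - dot (avgs s u) (avgs s u).
Proof.
rewrite dotDl !dotDr !dotNl !dotNr (dotC (avgs s u) u) dot_avgs; ring.
Qed.

(** The eigenvalue [1 + t^-1 (-t)^s] is positive for s = 0, zero for s = 1 and at least 3/4 for s >=
    2. In the induction the factor [t^-1] cancels the [t] of the residual term, which reduces that
    term to [contrs_gap]. *)
Lemma linear_part_gap s u :
  3 / 4 * dot (u - linear_part s u) (u - linear_part s u) <=
  dot u u + t^-1 * dot u (contrs s u).
Proof.
have ti : t * t^-1 = 1 by rewrite divff // gt_eqF.
have ti0 : 0 < t^-1 by rewrite invr_gt0.
elim: s u => [|i s IH] u.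
  by rewrite /= subrr -(scale0r 0) dotZl mul0r mulr0; have := dot_ge0 u; nra.
rewrite dot_contrs_cons (dot_resK i u).
have -> : u - linear_part (i :: s) u =
    (E i u - linear_part s (E i u)) + (res i u - avgs s (res i u)).
  by rewrite -{1}(resK i u) /= opprD addrACA.
rewrite (@norm_split i).
- have := IH (E i u); have := contrs_gap s (res i u); rewrite -norm_sub_avgs.
  set a := dot (E i u) (contrs _ _); set b := dot (res i u) (contrs _ _).
  rewrite mulrBr mulrA [t^-1 * t]mulrC ti; lra.
- by rewrite linearB /= linear_part_E E_idem.
by rewrite linearB /= avgs_E E_res -(scale0r 0) avgsZ !scale0r subrr.
Qed.

End CommutingProjections.

(** * Averages over one coordinate *)

Section CoordinateAverages.
Context {R : realFieldType} {n : nat} {T : finType}.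
Local Notation Om := {ffun 'I_n -> T}.
Local Notation V := {ffun {ffun 'I_n -> T} -> R^o}.
Implicit Types A B : V.

Definition dotf A B : R := \sum_u A u * B u.

(** Conditional expectation given the coordinates other than [i]. *)
Definition avg (i : 'I_n) A : V := [ffun u => #|T|%:R^-1 * \sum_a A (upd u i a)].

Lemma avg_is_linear i : linear (avg i).
Proof.
move=> c A B; apply/ffunP => u; rewrite !ffunE.
under eq_bigr do rewrite !ffunE.
by rewrite big_split /= -scaler_sumr mulrDr scalerAr.
Qed.

HB.instance Definition _ i := GRing.isLinear.Build R V V _ (avg i) (avg_is_linear i).

Definition avgL i : {linear V -> V} := avg i.

Lemma dotfDl A B C : dotf (A + B) C = dotf A C + dotf B C.
Proof.
by rewrite -big_split; apply: eq_bigr => u _; rewrite ffunE mulrDl.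
Qed.

Lemma dotfZl a A B : dotf (a *: A) B = a * dotf A B.
Proof. by rewrite big_distrr; apply: eq_bigr => u _; rewrite ffunE /= mulrA. Qed.

Lemma dotfC A B : dotf A B = dotf B A.
Proof. by apply: eq_bigr => u _; rewrite mulrC. Qed.

Lemma dotf_ge0 A : 0 <= dotf A A.
Proof. by apply: sumr_ge0 => u _; rewrite -expr2 sqr_ge0. Qed.

Lemma avg_sym i A B : dotf (avgL i A) B = dotf A (avgL i B).
Proof.
rewrite /dotf.
under eq_bigr do rewrite ffunE -mulrA big_distrl.
under [RHS]eq_bigr do rewrite ffunE mulrCA big_distrr.
rewrite -!mulr_sumr /=; congr (_ * _); rewrite (sum_upd_swap i).
by apply: eq_bigr => u _; apply: eq_bigr => a _; rewrite upd_upd upd_id.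
Qed.

Lemma avg_upd i A u a : avgL i A (upd u i a) = avgL i A u.
Proof. by rewrite !ffunE; under eq_bigr do rewrite upd_upd. Qed.

Hypothesis T0 : (0 < #|T|)%N.

Lemma avg_fixed i A : (forall u a, A (upd u i a) = A u) -> avgL i A = A.
Proof.
move=> h; apply/ffunP => u; rewrite ffunE; under eq_bigr do rewrite h.
by rewrite sumr_const -[A u *+ _]mulr_natl mulKf // pnatr_eq0 -lt0n.
Qed.

Lemma avg_idem i A : avgL i (avgL i A) = avgL i A.
Proof. by apply: avg_fixed => u a; rewrite avg_upd. Qed.

Lemma avg_comm i k A : avgL i (avgL k A) = avgL k (avgL i A).
Proof.
have [->//|ik] := eqVneq i k.
apply/ffunP => u; rewrite !ffunE; congr (_ * _).
under eq_bigr do rewrite ffunE; under [RHS]eq_bigr do rewrite ffunE.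
rewrite -!mulr_sumr exchange_big; congr (_ * _).
by apply: eq_bigr => a _; apply: eq_bigr => b _; rewrite updC.
Qed.

Lemma fixed_upd i A u a : avgL i A = A -> A (upd u i a) = A u.
Proof. by move=> <-; rewrite avg_upd. Qed.

Lemma fixed_eq (s : seq 'I_n) A (u v : Om) :
  (forall k, k \in s -> avgL k A = A) -> (forall k, k \notin s -> u k = v k) ->
  A u = A v.
Proof.
elim: s u => [|k s IH] u h e; first by congr (A _); apply/ffunP => k; rewrite e.
rewrite -(@fixed_upd k A u (v k)) ?h ?mem_head //.
apply: IH => [l ls|l ls]; first by rewrite h // inE ls orbT.
by rewrite ffunE; case: eqP => [->//|/eqP lk]; rewrite e // inE negb_or lk.
Qed.

Lemma avgs_fixed (s : seq 'I_n) k A : k \in s -> avgL k (avgs avgL s A) = avgs avgL s A.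
Proof.
elim: s => //= i s IH; rewrite inE => /orP[/eqP->|ks]; first by rewrite avg_idem.
by rewrite avg_comm; congr (avg _ _); exact: IH.
Qed.

(** The term added for [i] is averaged over every other coordinate, so it is a function of [u i]
    alone and can be read off at a base point. *)
Lemma linear_part_additive (s : seq 'I_n) A :
  (forall k, k \notin s -> avgL k A = A) ->
  exists c phi, forall u, linear_part avgL s A u = @additive_fun R n T c phi u.
Proof.
case/card_gt0P: (T0) => t0 _; pose u0 : Om := [ffun=> t0].
elim: s A => [|i s IH] A h.
  exists (A u0), (fun _ _ => 0) => u; rewrite /additive_fun big1 // addr0 /=.
  by apply: (@fixed_eq (enum 'I_n)) => k; [rewrite h | rewrite mem_enum].
have [k ks|c [phi hphi]] := IH (avgL i A).
  have [->|ki] := eqVneq k i; first by rewrite avg_idem.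
  by rewrite avg_comm h // inE negb_or ki.
pose B := avgs avgL s (res avgL i A).
exists c, (fun k a => phi k a + (if k == i then B (upd u0 i a) else 0)) => u.
rewrite /= [LHS]ffunE hphi /additive_fun big_split /= addrA; congr (_ + _).
rewrite -big_mkcond big_pred1_eq; apply: (@fixed_eq (rem i (enum 'I_n))).
  move=> k; rewrite mem_rem_uniq ?enum_uniq // inE => /andP[/= ki _].
  have [ks|ks] := boolP (k \in s); first exact: avgs_fixed.
  rewrite /B (avgs_E avg_comm) (res_E avg_comm) h // inE negb_or ki //.
move=> k; rewrite mem_rem_uniq ?enum_uniq // inE mem_enum andbT negbK => /eqP->.
by rewrite upd_eq.
Qed.

(** The mean of [b] over the values other than [a]. *)
Definition shrink (b : T -> R) (a : T) : R :=
  (#|T|%:R - 1)^-1 * (\sum_a' b a' - b a).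

Hypothesis T1 : (1 < #|T|)%N.

Local Notation t := ((#|T|%:R - 1)^-1 : R).

(** For this [t], [contr] resamples coordinate [i] among the values different from the present
    one. *)
Lemma contr_avgE i A u :
  contr avgL t i A u = t * (\sum_a A (upd u i a) - A u).
Proof.
rewrite /contr /res !ffunE /=.
have q1 : #|T|%:R - 1 != 0 :> R by rewrite subr_eq0 pnatr_eq1; lia.
have q0 : #|T|%:R != 0 :> R by rewrite pnatr_eq0; lia.
by rewrite /GRing.scale /=; field; apply/andP.
Qed.

Definition prodf (b : 'I_n -> T -> R) : V := [ffun u : Om => \prod_i b i (u i)].

Lemma contrs_prodf (s : seq 'I_n) b : uniq s ->
  contrs avgL t s (prodf b) =
  prodf (fun i => if i \in s then shrink (b i) else b i).
Proof.
elim: s => [_|i s IH /= /andP[nis us]]; first by apply/ffunP => u; rewrite !ffunE.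
rewrite IH //; apply/ffunP => u; rewrite contr_avgE.
have E c v : prodf c v = c i (v i) * \prod_(k | k != i) c k (v k).
  by rewrite ffunE (bigD1 i).
under eq_bigr => a _.
  rewrite E upd_eq (eq_bigr (fun k => (if k \in s then shrink (b k) else b k) (u k))).
    over.
  by move=> k ki; rewrite upd_neq.
rewrite !E (negbTE nis) mem_head -big_distrl /= -mulrBl mulrA; congr (_ * _).
by apply: eq_bigr => k ki; rewrite inE (negbTE ki).
Qed.

Lemma prodf_delta (v u : Om) :
  prodf (fun i a => (a == v i)%:R) u = (u == v)%:R.
Proof.
rewrite ffunE; have [->|] := eqVneq u v; first by rewrite big1 // => i _; rewrite eqxx.
move=> uv; have [i ui] : exists i, u i != v i.
  apply/existsP; rewrite -negb_forall; apply: contra uv => /forallP h.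
  by apply/eqP/ffunP => i; apply/eqP.
by rewrite (bigD1 i) //= (negbTE ui) mul0r.
Qed.

Lemma ffun_delta A :
  A = \sum_v A v *: prodf (fun i a => (a == v i)%:R).
Proof.
apply/ffunP => u; rewrite sum_ffunE (bigD1 u) //= !ffunE.
rewrite [X in A u *: X]big1 => [|i _]; last by rewrite eqxx.
rewrite big1 ?addr0 => [|v vu]; first by rewrite /GRing.scale /= mulr1.
by rewrite ffunE prodf_delta eq_sym (negbTE vu) scaler0.
Qed.

(** Point masses are product functions, and on products [contrs] acts factor by factor. *)
Lemma contrs_kernel A u :
  contrs avgL t (enum 'I_n) A u =
  \sum_v A v * \prod_i shrink (fun a => (a == v i)%:R) (u i).
Proof.
rewrite {1}(ffun_delta A).
rewrite (big_morph (contrs avgL t (enum 'I_n)) (id1 := 0) (op1 := +%R)); first last.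
- by rewrite -(scale0r 0) contrsZ !scale0r.
- exact: contrsD.
rewrite sum_ffunE; apply: eq_bigr => v _.
rewrite contrsZ contrs_prodf ?enum_uniq // !ffunE /GRing.scale /=; congr (_ * _).
by apply: eq_bigr => i _; rewrite mem_enum.
Qed.

End CoordinateAverages.

(** * Pairs of position vectors of a random profile *)

Definition pos {m n : nat} (j : 'I_m) (x : profile m n) : {ffun 'I_n -> 'I_m} :=
  [ffun i => ((x i)^-1)%g j].

Section Permutations.
Context {R : realFieldType} {m : nat}.
Implicit Types (al be : 'I_m -> R) (j k : 'I_m).

Lemma sum_perm_pos al j :
  \sum_(s : 'S_m) al ((s^-1)%g j) = (m.-1)`!%:R * \sum_a al a.
Proof.
have Sk k : \sum_(s : 'S_m) al ((s^-1)%g k) = \sum_(s : 'S_m) al ((s^-1)%g j).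
  rewrite (reindex_inj (mulIg (tperm j k))); apply: eq_bigr => s _.
  by rewrite invMg tpermV permM tpermR.
have m0 : (0 < m)%N := leq_ltn_trans (leq0n j) (ltn_ord j).
have : \sum_k \sum_(s : 'S_m) al ((s^-1)%g k) = m`!%:R * \sum_a al a.
  rewrite exchange_big (eq_bigr (fun=> \sum_a al a)) => [|s _]; last first.
    by rewrite [RHS](reindex_inj (@perm_inj _ (s^-1)%g)).
  by rewrite sumr_const card_Sn mulr_natl.
rewrite (eq_bigr _ (fun k _ => Sk k)) sumr_const card_ord -[_ *+ _]mulr_natl.
have -> : m`! = (m * (m.-1)`!)%N by rewrite -{1}(prednK m0) factS prednK.
rewrite natrM -mulrA => /mulfI; apply.
by rewrite pnatr_eq0 -lt0n.
Qed.

(** By symmetry [k] may be averaged over all alternatives other than [j], whose ranks are exactly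
    those different from the rank of [j]. *)
Lemma sum_perm_pos2 al be j k : j != k ->
  \sum_(s : 'S_m) al ((s^-1)%g j) * be ((s^-1)%g k) =
  (m.-1)`!%:R * \sum_a al a * shrink be a.
Proof.
move=> jk.
have Sk l : l != j -> \sum_(s : 'S_m) al ((s^-1)%g j) * be ((s^-1)%g l) =
    \sum_(s : 'S_m) al ((s^-1)%g j) * be ((s^-1)%g k).
  move=> lj; rewrite (reindex_inj (mulIg (tperm k l))); apply: eq_bigr => s _.
  by rewrite invMg tpermV !permM tpermR tpermD // eq_sym.
have m1 : (m%:R - 1 : R) != 0.
  rewrite subr_eq0 pnatr_eq1; move: jk (ltn_ord j) (ltn_ord k).
  by rewrite -val_eqE /=; lia.
have : \sum_(l | l != j) \sum_(s : 'S_m) al ((s^-1)%g j) * be ((s^-1)%g l) =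
    (m.-1)`!%:R * \sum_a al a * (\sum_b be b - be a).
  rewrite -(sum_perm_pos (fun a => al a * (\sum_b be b - be a)) j) exchange_big.
  apply: eq_bigr => s _; rewrite -big_distrr /=; congr (_ * _).
  rewrite [X in _ = X - _](reindex_inj (@perm_inj _ (s^-1)%g)).
  by rewrite [X in _ = X - _](bigD1 j) //= addrAC subrr add0r.
rewrite (eq_bigr _ Sk) sumr_const.
have -> : #|[pred l | l != j]| = m.-1 by rewrite -[X in _ = X.-1]card_ord (cardC1 j).
have m0 : (0 < m)%N := leq_ltn_trans (leq0n j) (ltn_ord j).
rewrite -[_ *+ _]mulr_natl -subn1 natrB // => /(canRL (mulKf m1)) ->.
rewrite mulrCA subn1; congr (_ * _); rewrite big_distrr; apply: eq_bigr => a _.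
by rewrite mulrCA /shrink card_ord.
Qed.

Context {n : nat}.
Local Notation c := ((m.-1)`!%:R ^+ n : R).
Local Notation Om := {ffun 'I_n -> 'I_m}.
Implicit Types A B : {ffun {ffun 'I_n -> 'I_m} -> R^o}.

Lemma sum_profile_prod (g : 'I_n -> 'S_m -> R) :
  \sum_(x : profile m n) \prod_i g i (x i) = \prod_i \sum_s g i s.
Proof. by rewrite bigA_distr_bigA. Qed.

Lemma sum_delta (G : Om -> R) (u : Om) :
  \sum_(v : Om) G v * \prod_i (u i == v i)%:R = G u.
Proof.
have E (v : Om) : \prod_i (u i == v i)%:R = (u == v)%:R :> R.
  by rewrite -(prodf_delta (R := R) v u) ffunE.
rewrite (bigD1 u) //= E eqxx mulr1 big1 ?addr0 // => v vu.
by rewrite E eq_sym (negbTE vu) mulr0.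
Qed.

Lemma sum_profile_pos (G : Om -> R) j :
  \sum_(x : profile m n) G (pos j x) = c * \sum_u G u.
Proof.
under eq_bigr do rewrite -sum_delta.
rewrite exchange_big big_distrr; apply: eq_bigr => u _ /=.
rewrite -big_distrr mulrC /=; congr (_ * _).
under eq_bigr do under eq_bigr do rewrite ffunE.
rewrite (sum_profile_prod (fun i s => ((s^-1)%g j == u i)%:R)).
rewrite (eq_bigr (fun=> (m.-1)`!%:R)) ?prodr_const ?card_ord // => i _.
rewrite (sum_perm_pos (fun a => (a == u i)%:R)) (bigD1 (u i)) //= eqxx big1 ?addr0 ?mulr1 //.
by move=> a /negbTE ->.
Qed.

(** The voters are independent, so the joint law of the two position vectors is a product of
    single-voter kernels [shrink], and this product is the kernel of [contrs]. *)
Lemma sum_profile_pos2 A B j k : j != k ->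
  \sum_(x : profile m n) A (pos j x) * B (pos k x) =
  c * dotf A (contrs avgL (m%:R - 1)^-1 (enum 'I_n) B).
Proof.
move=> jk.
have m0 : (1 < #|'I_m|)%N.
  by rewrite card_ord; move: jk (ltn_ord j) (ltn_ord k); rewrite -val_eqE /=; lia.
have E x : A (pos j x) * B (pos k x) = \sum_u \sum_v A u * (B v *
    \prod_i ((((x i)^-1)%g j == u i)%:R * (((x i)^-1)%g k == v i)%:R)).
  rewrite -(sum_delta A) big_distrl; apply: eq_bigr => u _ /=.
  rewrite -(sum_delta B) big_distrr; apply: eq_bigr => v _ /=.
  rewrite mulrACA -big_split -mulrA; congr (_ * (_ * _)).
  by apply: eq_bigr => i _; rewrite !ffunE.
rewrite (eq_bigr _ (fun x _ => E x)) exchange_big big_distrr; apply: eq_bigr => u _ /=.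
have -> : contrs avgL (m%:R - 1)^-1 (enum 'I_n) B u =
    \sum_v B v * \prod_i shrink (fun a => (a == v i)%:R) (u i).
  rewrite -contrs_kernel ?card_ord //; by rewrite card_ord in m0 => //; exact: ltnW.
rewrite exchange_big /= !big_distrr.
apply: eq_bigr => v _ /=.
rewrite -mulr_sumr [RHS]mulrCA; congr (_ * _).
rewrite -mulr_sumr [RHS]mulrCA; congr (_ * _).
rewrite (sum_profile_prod (fun i s => (((s^-1)%g j == u i)%:R * ((s^-1)%g k == v i)%:R))).
rewrite -[X in _ ^+ X](card_ord n) -prodr_const -big_split; apply: eq_bigr => i _ /=.
rewrite (sum_perm_pos2 (fun a => (a == u i)%:R) (fun a => (a == v i)%:R) jk).
congr (_ * _); rewrite (bigD1 (u i)) //= eqxx mul1r big1 ?addr0 //.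
by move=> a /negbTE ->; rewrite mul0r.
Qed.

Lemma dotf_suml (I : finType) (F : I -> {ffun Om -> R^o}) B :
  dotf (\sum_i F i) B = \sum_i dotf (F i) B.
Proof.
apply: (big_morph (fun A => dotf A B)); first by move=> *; rewrite dotfDl.
by rewrite -(scale0r 0) dotfZl mul0r.
Qed.

Lemma dotf_sumr (I : finType) (F : I -> {ffun Om -> R^o}) B :
  dotf B (\sum_i F i) = \sum_i dotf B (F i).
Proof. by rewrite dotfC dotf_suml; apply: eq_bigr => i _; rewrite dotfC. Qed.

(* Off-diagonal pairs are correlated through [contrs], with eigenvalue
   (-1/(m-1))^s on the functions of degree s: splitting the family into its mean
   and its deviations diagonalizes the quadratic form. *)
Lemma near_additive (A : 'I_m -> {ffun {ffun 'I_n -> 'I_m} -> R^o}) : (3 <= m)%N ->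
  exists (e : 'I_m -> R) (phi : 'I_n -> 'I_m -> R), forall j,
    c * \sum_u (A j u - additive_fun (e j) phi u) ^+ 2 <=
    3 * \sum_(x : profile m n) (\sum_k A k (pos k x)) ^+ 2.
Proof.
move=> m3.
have T0 : (0 < #|'I_m|)%N by rewrite card_ord; lia.
have mR : (3 <= m%:R :> R) by rewrite ler_nat.
have mn0 : m%:R != 0 :> R by lra.
pose t : R := (m%:R - 1)^-1.
have t0 : 0 < t by rewrite invr_gt0; lra.
(* This is where [m >= 3] enters; at [t = 1], the case of two alternatives, the gap [1 - t^2] would
   vanish. *)
have t12 : t <= 2^-1 by rewrite lef_pV2 ?posrE; lra.
have ti : t^-1 = m%:R - 1 by rewrite invrK.
pose K := contrs (@avgL R n 'I_m) t (enum 'I_n).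
pose S := \sum_j A j; pose M := m%:R^-1 *: S.
have SM : S = m%:R *: M by rewrite scalerA divff // scale1r.
pose b X Y := dotf X Y - dotf X (K Y).
have bE X Y : b X Y = dotf X Y - dotf X (K Y) by [].
clearbody b.
have KD X Y : K (X + Y) = K X + K Y by exact: contrsD.
have KZ a X : K (a *: X) = a *: K X by exact: contrsZ.
have dZr a X Y : dotf X (a *: Y) = a * dotf X Y by rewrite dotfC dotfZl dotfC.
have dDr X Y Z : dotf X (Y + Z) = dotf X Y + dotf X Z.
  by rewrite dotfC dotfDl !(dotfC X).
have Ksum (F : 'I_m -> {ffun Om -> R^o}) : K (\sum_j F j) = \sum_j K (F j).
  by apply: (big_morph K KD); rewrite -(scale0r 0) KZ !scale0r.
have bN X Y : b (X - M) (Y - M) = b X Y - b X M - b M Y + b M M.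
  rewrite !bE -scaleN1r !(KD, KZ, dotfDl, dDr, dZr, dotfZl); ring.
have devs : \sum_j b (A j) (A j) = \sum_j b (A j - M) (A j - M) + m%:R * b M M.
  under [in RHS]eq_bigr do rewrite bN.
  rewrite !big_split /= !sumrN sumr_const card_ord -[b M M *+ m]mulr_natl.
  have -> : \sum_j b (A j) M = m%:R * b M M.
    by under eq_bigr do rewrite bE; rewrite bE sumrB -!dotf_suml -/S SM !dotfZl -mulrBr.
  have -> : \sum_j b M (A j) = m%:R * b M M.
    by under eq_bigr do rewrite bE; rewrite bE sumrB -!dotf_sumr -Ksum -/S SM KZ !dZr -mulrBr.
  ring.
(* On the mean, the diagonal gives [m * b M M] and the full double sum [m^2 * dotf M (K M)]. As
   [m - 1 = t^-1], they combine into the form of [linear_part_gap]. *)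
have Q : \sum_(x : profile m n) (\sum_k A k (pos k x)) ^+ 2 =
    c * (\sum_j b (A j - M) (A j - M) + m%:R * (dotf M M + t^-1 * dotf M (K M))).
  transitivity (c * (\sum_j b (A j) (A j) + dotf S (K S))); last first.
    rewrite devs SM KZ dotfZl dZr bE ti; ring.
  have -> : dotf S (K S) = \sum_j \sum_k dotf (A j) (K (A k)).
    by rewrite Ksum dotf_suml; apply: eq_bigr => j _; rewrite dotf_sumr.
  rewrite -big_split big_distrr /=.
  under eq_bigr do rewrite expr2 big_distrl /=.
  rewrite exchange_big; apply: eq_bigr => j _ /=.
  rewrite bE; under eq_bigr do rewrite big_distrr /=.
  rewrite exchange_big (bigD1 j) //= [X in _ = _ * (_ + X)](bigD1 j) //=.
  rewrite addrA subrK mulrDr; congr (_ + _).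
    by rewrite (sum_profile_pos (fun u => A j u * A j u)).
  rewrite big_distrr; apply: eq_bigr => k kj.
  by rewrite sum_profile_pos2 // eq_sym.
have Ms := @avg_sym R n 'I_m.
have Mi := @avg_idem R n 'I_m T0.
have Mc := @avg_comm R n 'I_m.
have [c0 [phi Lphi]] : exists c0 phi, forall u,
    linear_part avgL (enum 'I_n) M u = @additive_fun R n 'I_m c0 phi u.
  by apply: linear_part_additive => // k; rewrite mem_enum.
case/card_gt0P: (T0) => a0 _; pose u0 : Om := [ffun=> a0].
(* The deviations from [M] contribute only constants, so one [phi], taken from the linear part of
   [M], serves every [j]. *)
pose D j := A j - M; pose e j := avgs avgL (enum 'I_n) (D j) u0.
have eE j u : avgs avgL (enum 'I_n) (D j) u = e j.
  apply: (@fixed_eq R n 'I_m (enum 'I_n)) => k; last by rewrite mem_enum.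
  exact: avgs_fixed.
exists (fun j => c0 + e j), phi => j.
have cp : 0 <= c by rewrite exprn_ge0.
rewrite Q mulrCA ler_wpM2l //.
pose P := M - linear_part avgL (enum 'I_n) M.
pose N k := D k - avgs avgL (enum 'I_n) (D k).
have gD k : 3 / 4 * dotf (N k) (N k) <= b (D k) (D k).
  rewrite bE /N (norm_sub_avgs (@dotfDl _ _ _) (@dotfZl _ _ _) (@dotfC _ _ _) Ms Mi Mc).
  exact: (contrs_gap (@dotfDl _ _ _) (@dotfZl _ _ _) (@dotfC _ _ _)
    (@dotf_ge0 _ _ _) Ms Mi Mc t0 t12).
have gM : 3 / 4 * dotf P P <= dotf M M + t^-1 * dotf M (K M).
  exact: (linear_part_gap (@dotfDl _ _ _) (@dotfZl _ _ _) (@dotfC _ _ _)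
    (@dotf_ge0 _ _ _) Ms Mi Mc t0 t12).
have gDj : 3 / 4 * dotf (N j) (N j) <= \sum_k b (D k) (D k).
  rewrite (bigD1 j) //= -[leLHS]addr0 lerD // sumr_ge0 // => k _.
  by apply: le_trans (gD k); rewrite mulr_ge0 ?dotf_ge0 //; lra.
have P0 := dotf_ge0 P.
have gM' : 3 / 4 * dotf P P <= m%:R * (dotf M M + t^-1 * dotf M (K M)).
  apply: (le_trans gM); apply: ler_peMl; last by lra.
  by apply: le_trans gM; rewrite mulr_ge0 //; lra.
(* The factor 2 here and 4/3 from the two gaps make 8/3, rounded up to 3. *)
have sq : \sum_u (A j u - additive_fun (c0 + e j) phi u) ^+ 2 <=
    2 * (dotf (N j) (N j) + dotf P P).
  rewrite /dotf -big_split big_distrr; apply: ler_sum => u _ /=.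
  have -> : A j u - additive_fun (c0 + e j) phi u = N j u + P u.
    rewrite !ffunE eE Lphi /additive_fun; ring.
  have := sqr_ge0 (N j u - P u); rewrite !expr2; move: (N j u) (P u) => p q; lra.
have := dotf_ge0 (N j); lra.
Qed.

End Permutations.

(** * Replacing the profile by the positions of one alternative *)

Section Hybrid.
Local Open Scope nat_scope.
Context {m n : nat}.
Variables (f : profile m n -> 'S_m) (j : 'I_m).
Implicit Types (s y : 'S_m) (x z : profile m n).

Definition defect_count (i : 'I_n) : nat :=
  \sum_(x : profile m n) \sum_(y : 'S_m) ((((x i)^-1)%g j == (y^-1)%g j) &&
    (((f x)^-1)%g j != ((f (replace_vote x i y))^-1)%g j)).

(** The ballot [y] with two ranks exchanged so that [j] stands where [s] puts it. *)
Definition realign s y : 'S_m := (tperm ((s^-1)%g j) ((y^-1)%g j) * y)%g.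

Lemma realign_rank s y : ((realign s y)^-1)%g j = (s^-1)%g j.
Proof. by rewrite /realign invMg tpermV permM tpermR. Qed.

(** Two voters keep their ranks of [j] and trade the rest of their ballots; doing so twice changes
    nothing. *)
Lemma realignK s y : realign (realign s y) (realign y s) = s.
Proof.
by rewrite {1}/realign !realign_rank /realign mulgA [tperm _ _ in X in (X * _)%g]tpermC
  tperm2 mul1g.
Qed.

(** Each ballot that agrees with [s] on [j] arises once for every rank of [j] in [y]. *)
Lemma sum_realign (H : 'S_m -> nat) s :
  \sum_y H (realign s y) = m * \sum_(y : 'S_m | (y^-1)%g j == (s^-1)%g j) H y.
Proof.
rewrite (partition_big (fun y : 'S_m => (y^-1)%g j) predT) //=.
rewrite -[X in X * _](card_ord m) -sum_nat_const; apply: eq_bigr => b _.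
rewrite [RHS](reindex_inj (mulgI (tperm ((s^-1)%g j) b))) /=.
apply: eq_big => [y|y /eqP <-//].
by rewrite invMg permM tpermV (can2_eq (tpermK _ _) (tpermK _ _)) tpermL.
Qed.

Definition hybrid q x z : profile m n :=
  [ffun i : 'I_n => if i < q then realign (x i) (z i) else x i].

Lemma sum_hybrid q (F : profile m n -> profile m n -> nat) :
  \sum_x \sum_z F (hybrid q x z) (hybrid q z x) = \sum_x \sum_z F x z.
Proof.
rewrite !pair_big /= [RHS](reindex_inj
  (h := fun p => (hybrid q p.1 p.2, hybrid q p.2 p.1))) //.
apply: (@can_inj _ _ _ (fun p => (hybrid q p.1 p.2, hybrid q p.2 p.1))) => -[x z].
by congr (_, _); apply/ffunP => i; rewrite !ffunE /=; case: (i < q); rewrite ?realignK.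
Qed.

(** Consecutive hybrids differ only in the ballot of voter [k]. By [sum_hybrid] the current pair may
    be taken uniform, so the step is one re-randomization of that ballot; the factor [m] comes from
    [sum_realign]. *)
Lemma sum_hybrid_step (k : 'I_n) :
  m`! * \sum_x \sum_z
    (((f (hybrid k x z))^-1)%g j != ((f (hybrid k.+1 x z))^-1)%g j) =
  #|profile m n| * (m * defect_count k).
Proof.
pose P x z : nat :=
  ((f x)^-1)%g j != ((f (replace_vote x k (realign (x k) (z k))))^-1)%g j.
have -> : \sum_x \sum_z
    (((f (hybrid k x z))^-1)%g j != ((f (hybrid k.+1 x z))^-1)%g j) =
    \sum_x \sum_z P x z.
  rewrite -[RHS](sum_hybrid k); apply: eq_bigr => x _; apply: eq_bigr => z _.
  rewrite /P; set v := replace_vote _ _ _.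
  suff -> : hybrid k.+1 x z = v by [].
  apply/ffunP => i; rewrite /v.
  rewrite !ffunE ltnn ltnS; have [->|ik] := eqVneq i k; first by rewrite leqnn.
  by rewrite leq_eqVlt -(inj_eq val_inj) in ik *; rewrite (negbTE ik).
rewrite /defect_count !big_distrr; apply: eq_bigr => x _ /=.
have := sum_coord k (fun y => ((f x)^-1)%g j !=
  ((f (replace_vote x k (realign (x k) y)))^-1)%g j : nat).
rewrite card_Sn => ->; congr (_ * _).
rewrite (sum_realign (fun y => ((f x)^-1)%g j != ((f (replace_vote x k y))^-1)%g j : nat)).
congr (_ * _); rewrite big_mkcond; apply: eq_bigr => y _.
by rewrite eq_sym; case: eqP.
Qed.

(** The defects add up along the telescope of hybrids. Averaging fixes one [z], and the last hybrid
    then sees [x] only through the ranks of [j]. *)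
Lemma position_view : exists F : {ffun 'I_n -> 'I_m} -> 'I_m,
  m`! * \sum_(x : profile m n) (((f x)^-1)%g j != F (pos j x)) <=
  m * \sum_i defect_count i.
Proof.
pose G x := ((f x)^-1)%g j.
have [z hz] : exists z, m`! * \sum_x (G x != G (hybrid n x z)) <= m * \sum_i defect_count i.
  apply: ex_le_average; first by apply/card_gt0P; exists [ffun=> 1%g].
  rewrite -big_distrr exchange_big /=.
  apply: (@leq_trans (\sum_(k < n) m`! * \sum_x \sum_z
      (G (hybrid k x z) != G (hybrid k.+1 x z)))); last first.
    by rewrite !big_distrr leq_sum // => k _; rewrite sum_hybrid_step.
  rewrite -big_distrr leq_mul2l; apply/orP; right => /=.
  rewrite [leqRHS]exchange_big leq_sum // => x _.
  rewrite [leqRHS]exchange_big leq_sum // => z _.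
  have {1}-> : x = hybrid 0 x z by apply/ffunP => i; rewrite ffunE.
  suff tele q : (G (hybrid 0 x z) != G (hybrid q x z)) <=
      \sum_(k < q) (G (hybrid k x z) != G (hybrid k.+1 x z)) by exact: tele.
  elim: q => [|q IH]; first by rewrite eqxx.
  rewrite big_ord_recr /=; apply: leq_trans (leq_add IH (leqnn _)).
  case: eqP => //=; case: eqP => //=.
  by move=> -> h; case: eqP.
exists (fun u => G [ffun i => (tperm (u i) (((z i)^-1)%g j) * z i)%g]).
apply: leq_trans hz; rewrite leq_mul2l; apply/orP; right.
apply/eq_leq/eq_bigr => x _; congr (nat_of_bool (_ != G _)).
by apply/ffunP => i; rewrite !ffunE ltn_ord.
Qed.

End Hybrid.

(** * The outcome at one rank *)

Section SharedVoter.
Context {R : realFieldType} {n : nat} {T J : finType}.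
Local Notation Om := {ffun 'I_n -> T}.
Variables (A : J -> Om -> bool) (e : J -> R) (phi : 'I_n -> T -> R) (b : R).
Hypotheses (n0 : (0 < n)%N) (T2 : (2 <= #|T|)%N) (b0 : 0 <= b).
Hypothesis farA : forall j, (\sum_u far (A j) (e j) phi u)%:R <= b.
Hypothesis small_b : 5 * #|T|%:R ^+ 2 * b < #|{ffun 'I_n -> T}|%:R.

(* The families share the additive part up to constants, so on the common good
   set they differ by constants and are read off from one coordinate [i]. *)
Lemma shared_coordinate (j0 : J) :
  exists (i : 'I_n) (g : T -> bool) (bad : J -> pred Om),
    [/\ forall j, (\sum_u bad j u)%:R <= 5 * #|T|%:R * b,
        forall j a, exists2 u : Om, u i = a & ~~ bad j u,
        forall j u, ~~ bad j u -> A j0 u = g (u i) &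
        forall j u v, ~~ bad j u -> ~~ bad j v ->
          (A j u + A j0 v = A j v + A j0 u)%N].
Proof.
have TR : 2 <= #|T|%:R :> R by rewrite ler_nat.
have Tb : b <= #|T|%:R * b by apply: ler_peMl => //; lra.
have T2b : #|T|%:R * b <= #|T|%:R ^+ 2 * b.
  by rewrite expr2 -mulrA ler_peMl ?mulr_ge0 //; lra.
have fj := farA j0.
have [||i [g hg]] := @boolean_near_additive R n T (A j0) (e j0) phi => //.
  rewrite -(ltr_nat R) !natrM; apply: le_lt_trans small_b.
  have := ler_wpM2l (ler0n R #|T|) fj; move: T2b Tb b0.
  move: (b) (#|T|%:R : R) ((\sum_u far (A j0) (e j0) phi u)%:R : R) => q t s *.
  lra.
pose bad j (u : Om) := [|| far (A j) (e j) phi u, far (A j0) (e j0) phi u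
  | A j0 u != g (u i)].
(* The two [far] events cost [2 b <= #|T| b], and reading [A j0] from one coordinate costs
   [4 #|T| b]. *)
have sum_bad j : (\sum_u bad j u)%:R <= 5 * #|T|%:R * b.
  have le : (\sum_u bad j u <= \sum_u far (A j) (e j) phi u +
      (\sum_u far (A j0) (e j0) phi u + \sum_u (A j0 u != g (u i))))%N.
    rewrite -!big_split; apply: leq_sum => u _.
    by rewrite /bad; case: (far (A j)); case: (far (A j0)) => //; case: (_ != _).
  have := farA j; have := fj; move: le hg; rewrite -!(ler_nat R) !natrD !natrM.
  have := ler_wpM2l (ler0n R #|T|) fj.
  have := ler_wpM2r b0 TR.
  move: (b) (#|T|%:R : R) => q t.
  move: ((\sum_u bad j u)%:R : R) ((\sum_u far (A j) (e j) phi u)%:R : R).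
  move: ((\sum_u far (A j0) (e j0) phi u)%:R : R) ((\sum_u (A j0 u != g (u i)))%:R : R).
  by move=> *; lra.
exists i, g, bad; split => // [j a|j u|j u v].
- apply: coord_attained; rewrite -(ltr_nat R) natrM; apply: le_lt_trans small_b.
  have := ler_wpM2l (ler0n R #|T|) (sum_bad j); rewrite expr2.
  by move: (b) ((\sum_u bad j u)%:R : R) (#|T|%:R : R) => q s t *; lra.
- by rewrite /bad !negb_or negbK => /and3P[_ _ /eqP].
(* Up to an error below 1/8, [A j - A j0] is the constant [e j - e j0], so its integer values at two
   good points coincide. *)
rewrite /bad !negb_or /far -!ltNge /additive_fun.
move=> /and3P[+ + _] /and3P[+ + _]; rewrite !ltr_norml.
by case: (A j u); case: (A j0 u); case: (A j v); case: (A j0 v) => //= *;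
  exfalso; lra.
Qed.

End SharedVoter.

(** The two possible behaviours at one rank: a fixed alternative, or the one that voter [i] puts at
    rank [a]. *)
Definition choice_at {m n : nat} (p : 'I_m + 'I_n * 'I_m) (x : profile m n) : 'I_m :=
  match p with inl j => j | inr (i, a) => x i a end.

Section Rank.
Context {R : realFieldType} {m n : nat}.
Variables (f : profile m n -> 'S_m) (F : 'I_m -> {ffun 'I_n -> 'I_m} -> 'I_m).
Variables (eps : R).
Hypotheses (m3 : (3 <= m)%N) (n1 : (1 <= n)%N) (eps0 : 0 <= eps).
Hypothesis small_eps : 3841 * m%:R ^+ 5 * eps < 1.
Hypothesis viewF :
  (\sum_j \sum_(x : profile m n) (((f x)^-1)%g j != F j (pos j x)))%:R <=
  m%:R * eps * #|profile m n|%:R.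

Lemma choice_of_rank (r : 'I_m) : exists p : 'I_m + 'I_n * 'I_m,
  (\sum_x (f x r != choice_at p x))%:R <=
  3841 * m%:R ^+ 5 * eps * #|profile m n|%:R.
Proof.
pose c : R := (m.-1)`!%:R ^+ n.
pose N : R := #|{ffun 'I_n -> 'I_m}|%:R.
have c0 : 0 < c by rewrite exprn_gt0 // ltr0n fact_gt0.
have m0 : (0 < m)%N := leq_trans (isT : (0 < 3)%N) m3.
have Nx : #|profile m n|%:R = c * N.
  rewrite /c /N !card_ffun !card_ord card_Sn !natrX -exprMn -natrM.
  by rewrite -{1}(prednK m0) factS prednK // mulnC.
have N0 : 0 < N by rewrite ltr0n card_ffun !card_ord expn_gt0 m0.
have mR : 3 <= m%:R :> R by rewrite ler_nat.
have mn0 : m%:R != 0 :> R by lra.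
pose A j (u : {ffun 'I_n -> 'I_m}) := F j u == r.
(* With [1/m] subtracted, the sum over [j] vanishes when exactly one indicator holds. *)
pose Af j : {ffun {ffun 'I_n -> 'I_m} -> R^o} := [ffun u => (A j u)%:R - m%:R^-1].
have [e [phi hphi]] := near_additive Af m3.
pose y := m%:R ^+ 3 * eps.
have y0 : 0 <= y by rewrite mulr_ge0 // exprn_ge0 // ler0n.
(* The sum over alternatives is nonzero only where a view fails. There its square is at most [m^2],
   and such profiles have density at most [m * eps]. *)
have sq j : \sum_u (Af j u - additive_fun (e j) phi u) ^+ 2 <= 3 * y * N.
  rewrite -(ler_pM2l c0); apply: (le_trans (hphi j)).
  rewrite (_ : c * _ = 3 * (m%:R ^+ 2 * (m%:R * eps * #|profile m n|%:R))); last first.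
    rewrite Nx /y; ring.
  rewrite ler_wpM2l ?ler0n //.
  apply: le_trans (ler_wpM2l _ viewF); last by rewrite exprn_ge0 // ler0n.
  rewrite exchange_big natr_sum big_distrr; apply: ler_sum => x _ /=.
  have [/existsP[k0 hk0]|] := boolP [exists k, ((f x)^-1)%g k != F k (pos k x)].
    apply: (@le_trans _ _ (m%:R ^+ 2)); last first.
      rewrite ler_peMr ?exprn_ge0 ?ler0n // ler1n.
      by rewrite (bigD1 k0) //= hk0.
    rewrite -[leLHS]real_normK ?num_real // lerXn2r ?nnegrE ?ler0n //.
    apply: le_trans (ler_norm_sum _ _ _) _.
    rewrite -[X in _ <= X%:R](card_ord m) -sumr_const ler_sum // => k _.
    rewrite ffunE; have m1 : m%:R^-1 <= 1 :> R by rewrite invf_le1 ?ler1n ?ltr0n.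
    have m10 : 0 <= m%:R^-1 :> R by rewrite invr_ge0 ler0n.
    by rewrite ler_norml; case: (A k _) => /=; apply/andP; split; lra.
  rewrite negb_exists => /forallP h.
  rewrite (_ : \sum_k _ = 0) ?expr0n ?mulr_ge0 ?exprn_ge0 ?ler0n //.
  under eq_bigr do rewrite ffunE.
  rewrite sumrB sumr_const card_ord -[_ *+ m]mulr_natl divff //.
  rewrite (bigD1 (f x r)) //= big1 ?addr0 => [|k kr].
    by have := h (f x r); rewrite negbK /A permK => /eqP <-; rewrite eqxx subrr.
  have := h k; rewrite negbK /A => /eqP <-.
  by rewrite (can2_eq (permKV _) (permK _)) (negbTE kr).
(* Chebyshev at the threshold 1/16 of [far]: 768 = 3 * 16^2. *)
pose b := 768 * y * N.
have b0 : 0 <= b by rewrite !mulr_ge0 ?ler0n //; lra.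
have farA j : (\sum_u far (A j) (e j + m%:R^-1) phi u)%:R <= b.
  rewrite (_ : b = 256 * (3 * y * N)); last by rewrite /b; ring.
  rewrite -ler_pdivrMl ?ltr0n //; apply: le_trans (sq j).
  rewrite natr_sum big_distrr; apply: ler_sum => u _ /=.
  case E: (far _ _ _ u); last by rewrite mulr0 sqr_ge0.
  move: E; rewrite /far /additive_fun ffunE.
  have -> : (A j u)%:R - (e j + m%:R^-1 + \sum_i phi i (u i)) =
            (A j u)%:R - m%:R^-1 - (e j + \sum_i phi i (u i)) by ring.
  set z := _ - _ - _ => hz; rewrite mulr1 -[leRHS]real_normK ?num_real //.
  have : 16^-1 * 16^-1 <= `|z| * `|z| by rewrite ler_pM // invr_ge0 ler0n.
  by rewrite expr2; lra.
have Mb : 5 * m%:R ^+ 2 * b < N.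
  rewrite /b (_ : _ * _ = 3840 * (m%:R ^+ 5 * eps) * N); last by rewrite /y; ring.
  rewrite -[ltRHS]mul1r ltr_pM2r //; apply: le_lt_trans small_eps.
  by rewrite -mulrA ler_wpM2r ?ler_nat // mulr_ge0 // exprn_ge0 // ler0n.
(* The final [r] is the reference alternative [j0]: the rank is reused as an arbitrary element of
   ['I_m]. *)
have [] := @shared_coordinate R n 'I_m 'I_m A (fun j => e j + m%:R^-1) phi b n1 _ b0 farA _ r.
- by rewrite card_ord; exact: ltnW.
- by rewrite card_ord; exact: Mb.
move=> i [g [bad [sum_bad attained gE diffE]]].
rewrite card_ord in sum_bad.
pose Bad (x : profile m n) :=
  [exists j, (((f x)^-1)%g j != F j (pos j x)) || bad j (pos j x)].
(* The sets [bad j] together have density at most [3840 m^5 eps]; the failing views add at most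
   [m eps]. *)
have sum_Bad : (\sum_x Bad x)%:R <= 3841 * m%:R ^+ 5 * eps * #|profile m n|%:R.
  have le : (\sum_x Bad x <=
     \sum_j \sum_(x : profile m n) (((f x)^-1)%g j != F j (pos j x)) +
     \sum_j \sum_(x : profile m n) bad j (pos j x))%N.
    rewrite exchange_big [X in (_ + X)%N]exchange_big -big_split leq_sum // => x _ /=.
    case E: (Bad x) => //; case/existsP: E => j hj.
    rewrite (bigD1 j) //= [X in (_ + X)%N](bigD1 j) //=.
    case/orP: hj => ->; first by rewrite -addnA leq_addr.
    by rewrite addnCA leq_addr.
  have le2 : (\sum_j \sum_(x : profile m n) bad j (pos j x))%:R <=
      m%:R * (5 * m%:R * b) * c.
    rewrite natr_sum -[X in _ <= X%:R * _ * _](card_ord m) -mulrA mulr_natl -sumr_const.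
    apply: ler_sum => j _; rewrite natr_sum.
    rewrite (sum_profile_pos (fun u => (bad j u)%:R : R)) -/c mulrC ler_pM2r //.
    by rewrite -natr_sum.
  rewrite -(ler_nat R) natrD in le; apply: (le_trans le).
  have e5 : m%:R * (5 * m%:R * b) * c = 3840 * m%:R ^+ 5 * eps * #|profile m n|%:R.
    by rewrite Nx /b /y; ring.
  rewrite e5 in le2.
  have m5 : m%:R * (eps * #|profile m n|%:R) <= m%:R ^+ 5 * (eps * #|profile m n|%:R).
    rewrite ler_wpM2r ?mulr_ge0 ?ler0n // ler_eXnr //; lra.
  by move: le2 viewF m5; lra.
have [x0 gx0] : exists x, ~~ Bad x.
  apply: ex_good; rewrite -(ltr_nat R); apply: (le_lt_trans sum_Bad).
  by rewrite -[ltRHS]mul1r ltr_pM2r // Nx mulr_gt0.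
have good x : ~~ Bad x -> forall j, ~~ bad j (pos j x) /\ (f x r == j) = A j (pos j x).
  rewrite negb_exists => /forallP h j; have := h j; rewrite negb_or negbK.
  move=> /andP[/eqP E ->]; split=> //; rewrite /A -E (can2_eq (permKV _) (permK _)).
  by rewrite eq_sym.
suff [p hp] : exists p, forall x, ~~ Bad x -> f x r = choice_at p x.
  exists p; apply: le_trans sum_Bad; rewrite ler_nat leq_sum // => x _.
  by case E: (Bad x); rewrite ?leq_b1 // hp ?E ?eqxx.
have [/existsP[a /existsP[a' /andP[ga ga']]]|] :=
    boolP [exists a, exists a', g a && ~~ g a'].
  (* On good points [A r] takes both Boolean values, and [A j] differs from it by a constant, which
     must be 0. *)
  have AE j u : ~~ bad j u -> A j u = g (u i).
    move=> gu; have [v va gv] := attained j a; have [w wa gw] := attained j a'.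
    have := diffE j v w gv gw; have := diffE j u v gu gv.
    rewrite !(gE j) // va wa ga (negbTE ga').
    by move=> /eqP + /eqP; case: (A j u); case: (A j v); case: (A j w); case: (g _).
  have gf x : ~~ Bad x -> forall j, (f x r == j) = g (((x i)^-1)%g j).
    by move=> /good h j; have [hj ->] := h j; rewrite AE // ffunE.
  (* Exactly one alternative occupies rank [r] of [f x0], so [g] holds at a single rank, which [x0]
     reveals. *)
  exists (inr (i, ((x0 i)^-1)%g (f x0 r))) => x gx /=.
  have g1 : g (((x i)^-1)%g (f x r)) by rewrite -gf.
  have := gf _ gx0 (x0 i (((x i)^-1)%g (f x r))); rewrite permK g1 => /eqP ->.
  by rewrite permK permKV.
(* Now [A r] is constant on good points, hence so is every [A j]. *)
move=> gc; exists (inl (f x0 r)) => x gx /=.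
have gcE a a' : g a = g a'.
  move: gc; rewrite negb_exists => /forallP h.
  have := h a; have := h a'; rewrite !negb_exists => /forallP h1 /forallP h2.
  by move: (h1 a) (h2 a'); case: (g a); case: (g a').
apply/eqP; have [hx ->] := good _ gx (f x0 r); have [hx0] := good _ gx0 (f x0 r).
rewrite eqxx => A1; have := diffE _ _ _ hx hx0.
rewrite -A1 !(gE (f x0 r)) // (gcE (pos (f x0 r) x0 i) (pos (f x0 r) x i)).
by move/eqP; case: (A _ _); case: (g _).
Qed.

End Rank.

(** * Assembling the ranks *)

(** Given the other ballots, [d x] is fixed while [x i a] is uniform. *)
Lemma sum_vote_eq {m n : nat} (i : 'I_n) (a : 'I_m) (d : profile m n -> 'I_m) :
  (forall x y, d (upd x i y) = d x) ->
  (m * \sum_(x : profile m n) (x i a == d x) = #|profile m n|)%N.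
Proof.
move=> dE; have m0 : (0 < m)%N := leq_ltn_trans (leq0n a) (ltn_ord a).
have E b : (\sum_(y : 'S_m) (y a == b) = (m.-1)`!)%N.
  apply/eqP; rewrite -(eqr_nat rat) natr_sum (reindex_inj invg_inj) /=.
  rewrite (sum_perm_pos (fun k => (k == b)%:R : rat)) (bigD1 b) //= eqxx big1 ?addr0 ?mulr1 //.
  by move=> k /negbTE ->.
have := sum_upd_swap i (fun (x : profile m n) (_ : 'S_m) => (x i a == d x : nat)).
rewrite [LHS]exchange_big sum_nat_const card_Sn.
under [RHS]eq_bigr => x _.
  under eq_bigr do rewrite upd_eq dE.
  rewrite E; over.
rewrite sum_nat_const -{1}(prednK m0) factS prednK // => h.
by apply/eqP; rewrite -(@eqn_pmul2l (m.-1)`!) ?fact_gt0 // mulnCA mulnA h mulnC.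
Qed.


(** Equal choices always agree, and a choice from voter [i] agrees with one that ignores voter [i]
    with probability exactly [1 / m]. Both are excluded, so the choices are all constant or all from
    one voter, and injective. *)
Lemma compatible_choices {m n : nat} (p : 'I_m -> 'I_m + 'I_n * 'I_m) :
  (0 < m)%N ->
  (forall r r', r != r' ->
    m * \sum_x (choice_at (p r) x == choice_at (p r') x) < #|profile m n|)%N ->
  exists h : profile m n -> 'S_m,
    (is_constant h \/ is_dictatorial h) /\ forall x r, h x r = choice_at (p r) x.
Proof.
move=> m0 rare; pose r0 := Ordinal m0.
have inj_p : injective p.
  move=> r r' e; apply/eqP/negPn/negP => /rare; rewrite e.
  under eq_bigr do rewrite eqxx.
  by rewrite sum_nat_const muln1 ltnNge leq_pmull.
have clash r r' i a : r != r' -> p r = inr (i, a) ->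
    (forall x y, choice_at (p r') (upd x i y) = choice_at (p r') x) -> False.
  move=> rr' e d; have := rare _ _ rr'.
  rewrite -(sum_vote_eq a d) e ltn_mul2l ltnn andbF.
  by [].
have [[j0 e0]|[[i a0] e0]] : (exists j0, p r0 = inl j0) \/ (exists ia, p r0 = inr ia).
- by case: (p r0) => [j|ia]; [left; exists j | right; exists ia].
- have pl r : exists j, p r = inl j.
    case e: (p r) => [j|[i a]]; first by exists j.
    have rr0 : r != r0 by apply: contraTneq isT => h; rewrite h e0 in e.
    by case: (clash r r0 i a rr0 e) => x y; rewrite e0.
  pose q r := if p r is inl j then j else j0.
  have pq r : p r = inl (q r) by rewrite /q; case: (pl r) => j ->.
  have inj_q : injective q by move=> r r' e; apply: inj_p; rewrite !pq e.
  exists (fun=> perm inj_q); split; first by left; exists (perm inj_q).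
  by move=> x r; rewrite permE pq.
have pr r : exists a, p r = inr (i, a).
  case e: (p r) => [j|[k a]].
    have rr0 : r0 != r by apply: contraTneq isT => h; rewrite -h e0 in e.
    by case: (clash r0 r i a0 rr0 e0) => x y; rewrite e.
  have [ki|ki] := eqVneq k i; first by exists a; rewrite ki.
  have rr0 : r0 != r.
    by apply: contraTneq isT => h; move: e ki; rewrite -h e0 => -[-> _]; rewrite eqxx.
  by case: (clash r0 r i a0 rr0 e0) => x y; rewrite e /= upd_neq.
pose q r := if p r is inr (_, a) then a else a0.
have pq r : p r = inr (i, q r) by rewrite /q; case: (pr r) => a ->.
have inj_q : injective q by move=> r r' e; apply: inj_p; rewrite !pq e.
(* The product acts left to right, so this is [x i] after [q]. *)
exists (fun x : profile m n => (perm inj_q * x i)%g); split.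
  by right; exists i, (perm inj_q) => x r; rewrite permM.
by move=> x r; rewrite permM permE pq.
Qed.

(** * Normalizations and the final bound *)

Lemma frobenius_perm (R : realType) (m : nat) (s t : 'S_m) :
  frobenius_norm (perm_mx s - perm_mx t : 'M[R]_m) ^+ 2 =
  2 * \sum_r (s r != t r)%:R.
Proof.
rewrite sqr_sqrtr; last by do 2!apply: sumr_ge0 => ? _; rewrite exprn_ge0.
rewrite big_distrr; apply: eq_bigr => r _ /=.
under eq_bigr do rewrite !mxE real_normK ?num_real //.
have [<-|st] := eqVneq (s r) (t r).
  by rewrite mulr0 big1 // => b _; rewrite subrr expr0n.
have ts : t r != s r by rewrite eq_sym.
(* A row where the permutations differ has two nonzero entries, 1 and -1. *)
rewrite (bigD1 (s r)) // (bigD1 (t r)) //= big1 => [|b /andP[bs bt]].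
  by rewrite !eqxx (negbTE ts) (negbTE st) /=; ring.
by rewrite ![_ == b]eq_sym (negbTE bs) (negbTE bt) subrr expr0n.
Qed.

Lemma IR_sumE (R : realType) (m n : nat) (f : profile m n -> 'S_m) :
  (\sum_i \sum_j defect_count f j i)%:R =
  (\sum_i \sum_j IR_defect R f i j) * (m`!%:R * #|profile m n|%:R).
Proof.
have N0 : (0 < #|{: profile m n * 'S_m}|)%N.
  by apply/card_gt0P; exists ([ffun=> 1%g], 1%g).
rewrite mulr_suml natr_sum; apply: eq_bigr => i _.
rewrite mulr_suml natr_sum; apply: eq_bigr => j _.
rewrite /IR_defect /prob_unif -natrM [X in _ * X%:R](_ : _ = #|{: profile m n * 'S_m}|).
  rewrite divfK ?pnatr_eq0 -?lt0n //; congr (_%:R).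
  rewrite /defect_count pair_big /= -sum1_card [RHS]big_mkcond.
  by apply: eq_bigr => -[x y] _ /=; rewrite unfold_in /=; case: andb.
by rewrite card_prod card_Sn mulnC.
Qed.

Theorem theorem3p5 (R : realType) :
  exists C : R, 0 < C /\
    forall (m n : nat) (eps : R) (f : profile m n -> 'S_m),
      (3 <= m)%N -> (1 <= n)%N -> 0 <= eps -> is_IR eps f ->
      exists h : profile m n -> 'S_m,
        (is_constant h \/ is_dictatorial h) /\
        expectation_unif (fun x : profile m n =>
          frobenius_norm (perm_mx (f x) - perm_mx (h x) : 'M[R]_m) ^+ 2)
        <= C * m%:R ^+ 8 * eps.
Proof.
(* Twice the threshold constant 7682 below, because the squared distance never exceeds [2 m]. *)
exists 15364; split; first by rewrite ltr0n.
move=> m n eps f m3 n1 eps0 IR.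
have N0 : 0 < #|profile m n|%:R :> R.
  by rewrite ltr0n; apply/card_gt0P; exists [ffun=> 1%g].
have mR : 3 <= m%:R :> R by rewrite ler_nat.
have m1 : 1 <= m%:R :> R by lra.
have mX k l : (k <= l)%N -> m%:R ^+ k * eps <= m%:R ^+ l * eps.
  by move=> kl; rewrite ler_wpM2r // ler_weXn2l.
(* Below this threshold the errors at two ranks have total density under [1 / m], as
   [compatible_choices] requires; above it any constant [h] will do. *)
have [large|small] := leP 1 (7682 * m%:R ^+ 6 * eps).
  exists (fun=> 1%g); split; first by left; exists 1%g.
  rewrite /expectation_unif ler_pdivrMr //.
  have -> : 15364 * m%:R ^+ 8 * eps * #|profile m n|%:R =
      \sum_(x : profile m n) 15364 * m%:R ^+ 8 * eps.
    by rewrite sumr_const mulr_natr.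
  apply: ler_sum => x _; rewrite frobenius_perm.
  have le_m : \sum_r (f x r != (1%g : 'S_m) r)%:R <= m%:R :> R.
    rewrite -[X in _ <= X%:R](card_ord m) -sumr_const ler_sum // => r _.
    by rewrite lern1 leq_b1.
  have := ler_wpM2l (ler0n R m) large.
  have := mX 7 8 isT.
  rewrite !exprS; move: le_m; move: (\sum_r _) => s; lra.
have views j : exists F : {ffun 'I_n -> 'I_m} -> 'I_m,
    (m`! * \sum_(x : profile m n) (((f x)^-1)%g j != F (pos j x)) <=
     m * \sum_i defect_count f j i)%N by exact: position_view.
have [F hF] := fin_all_exists views.
have viewF : (\sum_j \sum_(x : profile m n) (((f x)^-1)%g j != F j (pos j x)))%:R <=
    m%:R * eps * #|profile m n|%:R.
  have mf0 : 0 < m`!%:R :> R by rewrite ltr0n fact_gt0.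
  rewrite -(ler_pM2l mf0) -natrM.
  apply: (@le_trans _ _ ((m * \sum_i \sum_j defect_count f j i)%N%:R)).
    rewrite ler_nat [X in (_ <= m * X)%N]exchange_big big_distrr [leqRHS]big_distrr /=.
    by apply: leq_sum => j _; exact: hF.
  rewrite natrM IR_sumE.
  have := ler_wpM2r (ltW (mulr_gt0 mf0 N0)) IR => /(ler_wpM2l (ler0n R m)) h.
  apply: (le_trans h); rewrite le_eqVlt; apply/orP; left; apply/eqP; ring.
have small5 : 3841 * m%:R ^+ 5 * eps < 1.
  apply: le_lt_trans small; have := mX 5 6 isT.
  have : 0 <= m%:R ^+ 6 * eps by rewrite mulr_ge0 // exprn_ge0 // ler0n.
  move: (m%:R ^+ 6) (m%:R ^+ 5) => a b; lra.
have [p hp] := fin_all_exists (choice_of_rank m3 n1 eps0 small5 viewF).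
have [||h [hform hE]] := @compatible_choices m n p; first exact: leq_trans m3.
  move=> r r' rr'; rewrite -(ltr_nat R) natrM.
  (* The values [f x r] and [f x r'] differ, so coinciding choices mean an error at one of the two
     ranks. *)
  have le : (\sum_x (choice_at (p r) x == choice_at (p r') x) <=
     \sum_x (f x r != choice_at (p r) x) + \sum_x (f x r' != choice_at (p r') x))%N.
    rewrite -big_split leq_sum // => x _ /=.
    have [<-|_] := eqVneq (f x r) (choice_at (p r) x); last first.
      exact: leq_trans (leq_b1 _) (leq_addr _ _).
    have [<-|_] := eqVneq (f x r') (choice_at (p r') x); last exact: leq_b1.
    by rewrite (inj_eq perm_inj) (negbTE rr').
  rewrite -(ler_nat R) natrD in le.
  have le2 := le_trans le (lerD (hp r) (hp r')).
  apply: (le_lt_trans (ler_wpM2l (ler0n R m) le2)).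
  rewrite (_ : _ * _ = 7682 * m%:R ^+ 6 * eps * #|profile m n|%:R); last by ring.
  by rewrite -[ltRHS]mul1r ltr_pM2r.
exists h; split => //; rewrite /expectation_unif ler_pdivrMr //.
under eq_bigr do rewrite frobenius_perm.
rewrite -big_distrr exchange_big /=.
(* The errors of all ranks add up to [7682 m^6 eps], which [mX] then compares with the power 8. *)
apply: (@le_trans _ _ (2 * \sum_(r < m) (3841 * m%:R ^+ 5 * eps * #|profile m n|%:R))).
  rewrite ler_wpM2l ?ler0n // ler_sum // => r _.
  apply: le_trans (hp r); rewrite natr_sum ler_sum // => x _.
  by rewrite hE.
rewrite sumr_const card_ord -[_ *+ m]mulr_natl.
rewrite (_ : 2 * _ = 7682 * (m%:R ^+ 6 * eps) * #|profile m n|%:R); last by ring.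
rewrite ler_pM2r //; have := mX 6 8 isT.
have : 0 <= m%:R ^+ 6 * eps by rewrite mulr_ge0 // exprn_ge0 // ler0n.
by move: (m%:R ^+ 6) (m%:R ^+ 8) => a b; lra.
Qed.
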